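(* If $G$ is a connected cubic graph on $n$ vertices that is not isomorphic to $K_4$, then $\mathrm{ssp}(G) \leq n$.
   Context: All graphs are finite and simple. Given a collection $\mathcal{P}$ of paths in a graph $G$, two edges $e,f$ of $G$ are separated by $\mathcal{P}$ if there are paths $P_e,P_f\in\mathcal{P}$ such that $P_e$ contains $e$ but not $f$, and $P_f$ contains $f$ but not $e$. $\mathcal{P}$ is a strongly separating path system of $G$ if it separates every pair of distinct edges of $G$. $\mathrm{ssp}(G)$ denotes the minimum size of a strongly separating path system of $G$. *)

(* Defs.v *)
From mathcomp Require Import all_boot.

Set Implicit Arguments.
Unset Strict Implicit.
Unset Printing Implicit Defensive.

Record sgraph := SGraph {
  vertex :> finType;
  adj : rel vertex;
  adj_sym : symmetric adj;
  adj_irrefl : irreflexive adj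
}.

Definition edges (G : sgraph) : {set {set G}} :=
  [set [set x; y] | x in G, y in G & adj x y].

Definition degree (G : sgraph) (x : G) : nat := #|[set y | adj x y]|.

Definition cubic (G : sgraph) : Prop := forall x : G, degree x = 3.

Definition connected (G : sgraph) : Prop :=
  0 < #|G| /\ forall x y : G, connect (@adj G) x y.

Definition isomorphic (G H : sgraph) : Prop :=
  exists2 f : G -> H, bijective f & forall x y, adj (f x) (f y) = adj x y.

Lemma complete_sym (T : finType) : symmetric (fun x y : T => x != y).
Proof. by move=> x y; rewrite eq_sym. Qed.

Lemma complete_irrefl (T : finType) : irreflexive (fun x y : T => x != y).
Proof. by move=> x; rewrite eqxx. Qed.

Definition complete (n : nat) : sgraph :=
  SGraph (@complete_sym 'I_n) (@complete_irrefl 'I_n).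

(* A path is identified with the subgraph that it traces, recorded as its
   vertex set and its edge set, so that the two traversals of a path give the
   same object. *)
Definition subgraph (G : sgraph) : Type := ({set G} * {set {set G}})%type.

Definition trace (G : sgraph) (s : seq G) : subgraph G :=
  ([set x in s], [set [set p.1; p.2] | p in zip s (behead s)]).

Definition simple_path (G : sgraph) (s : seq G) : bool :=
  uniq s && sorted (@adj G) s.

(* The bound on the length makes the quantifier finite; it excludes nothing,
   since the vertices are distinct (see is_pathP). *)
Definition is_path (G : sgraph) (H : subgraph G) : bool :=
  [exists k : 'I_#|G|, [exists s : k.+1.-tuple G,
     simple_path s && (H == trace s)]].

Lemma is_pathP (G : sgraph) (H : subgraph G) :
  reflect (exists s : seq G, [/\ s != [::], simple_path s & H = trace s])
          (is_path H).
Proof.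
apply: (iffP existsP) => [[k /existsP[s /andP[ps /eqP->]]]|[s [s0 ps ->]]].
  by exists s; split=> //; rewrite -size_eq0 size_tuple.
have us : uniq s by case/andP: ps.
have sz : (size s).-1.+1 = size s by rewrite prednK // lt0n size_eq0.
have lt : (size s).-1 < #|G| by rewrite sz -(card_uniqP us) max_card.
exists (Ordinal lt); apply/existsP.
have tP : size s == (Ordinal lt).+1 by rewrite /= sz.
by exists (Tuple tP); rewrite /= ps eqxx.
Qed.

Definition separated (G : sgraph) (P : {set subgraph G}) (e f : {set G}) :
    bool :=
  [exists Pe in P, (e \in Pe.2) && (f \notin Pe.2)] &&
  [exists Pf in P, (f \in Pf.2) && (e \notin Pf.2)].

Definition strongly_separating (G : sgraph) (P : {set subgraph G}) : bool :=
  [forall H in P, is_path H] &&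
  [forall e in edges G, forall f in edges G, (e != f) ==> separated P e f].

Lemma strongly_separating_ex (G : sgraph) :
  exists k, [exists P : {set subgraph G}, strongly_separating P && (#|P| == k)].
Proof.
set P := [set H : subgraph G | is_path H].
exists #|P|; apply/existsP; exists P; rewrite eqxx andbT; apply/andP; split.
  by apply/forall_inP=> H; rewrite inE.
have one e f : e \in edges G -> e != f ->
    [exists H in P, (e \in H.2) && (f \notin H.2)].
  case/imset2P=> x y _; rewrite inE => /andP[_ xy] -> nf.
  apply/existsP; exists (trace [:: x; y]).
  have nxy : x != y by apply: contraTneq xy => ->; rewrite adj_irrefl.
  apply/and3P; split.
  - rewrite inE; apply/is_pathP; exists [:: x; y]; split=> //.
    by rewrite /simple_path /= inE nxy xy.
  - by apply/imsetP; exists (x, y); rewrite // inE.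
  - apply: contra nf => /imsetP[p]; rewrite inE => /eqP-> /= ->.
    exact: eqxx.
apply/forall_inP=> e eG; apply/forall_inP=> f fG; apply/implyP=> ef.
by rewrite /separated !one // eq_sym.
Qed.

Definition ssp (G : sgraph) : nat := ex_minn (strongly_separating_ex G).

(* Main.v *)
(* Give every vertex [v] a neighbour [f v] with [f (f v) <> v], and name its
   other two neighbours [g v] and [h v].  Exactly n/2 edges are not of the form
   [{v, f v}].  From each of the n darts [(x, v)] on such an edge, walk
   [x, v, f v, f (f v), ...], continuing past [f w] exactly when [w] was entered
   from [g w].  Every edge then lies on two of these n walks, so it suffices
   that the walks are paths and that two of them share at most one edge.

   To achieve this, [f] goes around a cycle C and otherwise moves closer to C,
   where C is a triangle if there is one, and has length at least 5 otherwise.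
   On C, [h v] is the predecessor of [v], which stops every walk soon after it
   reaches C.  The remaining conflicts come from vertices with no [f]-preimage:
   the graph they induce has maximum degree 2, so each of its edges can be
   chosen as the [h]-edge of one of its ends. *)
Require Import Defs.
From mathcomp Require Import all_boot zify.

Set Implicit Arguments.
Unset Strict Implicit.
Unset Printing Implicit Defensive.

(** * Two-element sets, minimality of [ssp], and the edges of a trajectory *)

Lemma set2_inj (T : finType) (a b c d : T) :
  [set a; b] = [set c; d] -> (a = c /\ b = d) \/ (a = d /\ b = c).
Proof.
move=> eq2.
have : a \in [set c; d] by rewrite -eq2 set21.
have : b \in [set c; d] by rewrite -eq2 set22.
have : c \in [set a; b] by rewrite eq2 set21.
have : d \in [set a; b] by rewrite eq2 set22.
rewrite !in_set2.
by do 4![case/orP=> /eqP ?]; subst; auto.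
Qed.

Lemma ssp_leq (G : sgraph) (P : {set subgraph G}) :
  strongly_separating P -> ssp G <= #|P|.
Proof.
move=> sepP; rewrite /ssp; case: ex_minnP => m _; apply.
by apply/existsP; exists P; rewrite sepP eqxx.
Qed.

Lemma zip_behead_traject (T : Type) (f : T -> T) (v : T) (m : nat) :
  zip (traject f v m.+1) (behead (traject f v m.+1))
    = [seq (iter i f v, iter i.+1 f v) | i <- iota 0 m].
Proof.
elim: m v => //= m IHm v; congr (_ :: _).
have /= -> := IHm (f v).
have -> : iota 1 m = [seq 1 + i | i <- iota 0 m] by rewrite -iotaDl addn0.
by rewrite -map_comp; apply: eq_map => i /=; rewrite -iterSr.
Qed.

(** * The walks: they are paths, at most n of them, and they isolate every edge *)

Section Walks.

Variables (G : sgraph) (f g h : G -> G) (l : G -> nat).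
Hypothesis f2_neq : forall v, f (f v) != v.
Hypothesis adjE : forall v y, adj v y = [|| y == f v, y == g v | y == h v].
Hypothesis g_neq_f : forall v, g v != f v.
Hypothesis h_neq_f : forall v, h v != f v.
Hypothesis g_neq_h : forall v, g v != h v.
Hypothesis level_f : forall v, l (f v) = (l v).-1.
Hypothesis h_root : forall v, l v = 0 -> h (f v) = v.
(** Here [f (g v) != v] says that [(g v, v)] is a dart. Its walk stops at index at most [l v + 1]
    and takes one more step, whence the bounds. This condition keeps the start off the rest of the
    walk; the next one separates the walks of two opposite darts. *)
Hypothesis g_off_walk : forall v b, f (g v) != v -> 1 < b <= l v + 2 ->
  iter b f v != g v.
Hypothesis g_pair_disjoint : forall v i j, f (g v) != v -> g (g v) = v ->
  i <= (l v).+1 -> j <= (l (g v)).+1 -> iter i f v != iter j f (g v).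

(** An orientation of an edge that is not of the form [{v, f v}]. *)
Definition dart (x v : G) : bool := [&& adj x v, x != f v & f x != v].

Definition before (x v : G) (i : nat) : G :=
  if i is i'.+1 then iter i' f v else x.

Lemma adj_f v : adj v (f v). Proof. by rewrite adjE eqxx. Qed.

Lemma f_neq v : f v != v.
Proof. by apply: contraTneq (adj_f v) => ->; rewrite adj_irrefl. Qed.

Lemma level_iter i v : l (iter i f v) = l v - i.
Proof. by elim: i => [|i IHi]; rewrite ?subn0 //= level_f IHi subnS. Qed.

(** Levels drop strictly until they reach 0, so a repetition can only occur there, where the bound
    leaves at most two further steps; [f_neq] and [f2_neq] exclude a return after one or two. *)
Lemma iter_f_inj v i j : i <= l v + 2 -> j <= l v + 2 ->
  iter i f v = iter j f v -> i = j.
Proof.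
wlog lt_ij : i j / i < j.
  move=> H le_i le_j eq_ij; case: (ltngtP i j) => // lt_; first exact: H.
  by apply/esym; apply: H.
move=> _ le_j eq_ij; exfalso.
have := congr1 l eq_ij; rewrite !level_iter => eq_l.
have [k jE] : exists k, j = (k + i).+1 by exists (j - i).-1; lia.
subst j; move: eq_ij; rewrite -addSn iterD; set u := iter i f v.
have : k <= 1 by lia.
case: k {eq_l le_j lt_ij} => [|[|k]] //= _ equ; first by have := f_neq u; rewrite -equ eqxx.
by have := f2_neq u; rewrite -equ eqxx.
Qed.

Lemma stop_exists x v : exists i, before x v i == h (iter i f v).
Proof.
by exists (l v).+1; rewrite /= h_root ?level_iter ?subnn.
Qed.

Definition stop (x v : G) : nat := ex_minn (stop_exists x v).

Lemma stop_le x v : stop x v <= (l v).+1.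
Proof.
rewrite /stop; case: ex_minnP => m _; apply.
by rewrite /= h_root ?level_iter ?subnn.
Qed.

Lemma before_stop x v : before x v (stop x v) = h (iter (stop x v) f v).
Proof. by rewrite /stop; case: ex_minnP => m /eqP. Qed.

Lemma before_adj x v i : dart x v ->
  adj (iter i f v) (before x v i) && (before x v i != f (iter i f v)).
Proof.
case/and3P=> xv xfv _; case: i => [|i] /=; first by rewrite adj_sym xv xfv.
by rewrite adj_sym adj_f eq_sym f2_neq.
Qed.

Lemma before_lt_stop x v i : dart x v -> i < stop x v ->
  before x v i = g (iter i f v).
Proof.
move=> dxv; have := before_adj i dxv; rewrite adjE.
rewrite /stop; case: ex_minnP => m _ min_m.
case/andP=> /or3P[/eqP->|/eqP->//|/min_m]; first by rewrite eqxx.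
by move=> le_mi _; rewrite ltnNge le_mi.
Qed.

(** The walk still takes the [f]-edge out of its stopping vertex, so the indices after [x] run from
    0 to [stop x v + 1]. *)
Definition walk (x v : G) : seq G := x :: traject f v (stop x v).+2.

Lemma walk_path x v : dart x v -> simple_path (walk x v).
Proof.
move=> dxv; have [xv xfv fxv] := and3P dxv.
have le_st := stop_le x v.
apply/andP; split; last first.
  rewrite /= xv adj_f /=; apply: sub_path (fpath_traject f (f v) _).
  by move=> u w /= /eqP <-; apply: adj_f.
rewrite cons_uniq; apply/andP; split; last first.
  apply/(uniqP v) => i j; rewrite !inE !size_traject => lt_i lt_j.
  by rewrite !nth_traject //; apply: iter_f_inj; lia.
(* A dart excludes [x] at indices 0 and 1. A later index means that the walk continued past its
   first stop, hence [x = g v]. *)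
apply/negP => /trajectP[b lt_b def_x].
have b_gt1 : 1 < b.
  case: b {lt_b} def_x => [|[|b]] //= def_x.
    by move: xv; rewrite def_x adj_irrefl.
  by rewrite def_x eqxx in xfv.
have x_g : x = g v by apply: (@before_lt_stop x v 0) => //; lia.
have /negP[] : iter b f v != g v by apply: g_off_walk; rewrite -?x_g //; lia.
by rewrite -x_g -def_x.
Qed.

Lemma walk_edgeP x v e :
  reflect (e = [set x; v] \/
           exists2 i, i <= stop x v & e = [set iter i f v; iter i.+1 f v])
          (e \in (trace (walk x v)).2).
Proof.
have -> : (e \in (trace (walk x v)).2) =
    (e == [set x; v]) || [exists i : 'I_(stop x v).+1,
                     e == [set iter i f v; iter i.+1 f v]].
  have zipE : zip (walk x v) (behead (walk x v)) =
     (x, v) :: [seq (iter i f v, iter i.+1 f v) | i <- iota 0 (stop x v).+1].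
    by rewrite -zip_behead_traject.
  rewrite /trace zipE; apply/imsetP/orP => [[p]|].
    rewrite inE => /predU1P[-> /= ->|]; first by rewrite eqxx; left.
    case/mapP=> i; rewrite mem_iota add0n => /= lt_i -> ->; right.
    by apply/existsP; exists (Ordinal lt_i).
  case=> [/eqP->|/existsP[i /eqP->]]; first by exists (x, v); rewrite ?inE ?eqxx.
  exists (iter i f v, iter i.+1 f v) => //; rewrite inE; apply/orP; right.
  by apply/mapP; exists (val i); rewrite // mem_iota add0n ltn_ord.
apply: (iffP orP) => [[/eqP->|/existsP[i /eqP->]]|[->|[i le_i ->]]].
- by left.
- by right; exists i => //; rewrite -ltnS.
- by left.
- by right; apply/existsP; exists (Ordinal (le_i : i < (stop x v).+1)).
Qed.

Lemma f_edge_inj u w : [set u; f u] = [set w; f w] -> u = w.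
Proof.
case/set2_inj=> [[]//|[eq_u eq_w]].
by have := f2_neq w; rewrite -eq_u eq_w eqxx.
Qed.

Lemma dart_not_f_edge x v u : dart x v -> [set x; v] <> [set u; f u].
Proof.
case/and3P=> _ /eqP xfv /eqP fxv /set2_inj[[xu vu]|[xu vu]].
  by apply: fxv; rewrite xu.
by apply: xfv; rewrite vu.
Qed.

(** Trace backwards: if [f a] is not [w], then [(a, w)] is a dart and starts a walk; otherwise the
    walk that enters [a] from [g a] does not stop there and goes on through [w]. *)
Lemma transition_covered a w : adj a w -> a != f w ->
  exists x v i, [/\ dart x v, i <= stop x v, iter i f v = w & before x v i = a].
Proof.
pose L := \max_v l v.
have leL v : l v <= L by apply: leq_bigmax.
have extend b : (exists x v i, [/\ dart x v, i <= stop x v, iter i f v = b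
       & before x v i = g b]) ->
    exists x v i, [/\ dart x v, i <= stop x v, iter i f v = f b & before x v i = b].
  case=> x [v [i [dxv le_i iv bi]]]; exists x, v, i.+1; split=> //=.
    rewrite ltn_neqAle le_i andbT; apply: contraTneq (g_neq_h b) => i_st.
    by rewrite -bi i_st before_stop -i_st iv eqxx.
  by rewrite iv.
have adj_g b : adj (g b) b by rewrite adj_sym adjE eqxx orbT.
(* Stepping back from [a] above level 0 raises the level, so the tracing ends. By [h_root], [g a] is
   never a level 0 preimage of [a], so the side condition persists. *)
have tree m : forall a w, adj a w -> a != f w -> (f a = w -> 0 < l a) ->
    L - l w < m ->
    exists x v i, [/\ dart x v, i <= stop x v, iter i f v = w & before x v i = a].
  elim: m => // m IHm {}a {}w aw afw la lt_m.
  have [faw|nfaw] := eqVneq (f a) w; last first.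
    by exists a, w, 0; rewrite /dart aw afw nfaw.
  rewrite -faw; apply: extend; apply: IHm => //.
    move=> fga; rewrite lt0n; apply: contraNneq (g_neq_h a) => /h_root.
    by rewrite fga => ->.
  have := la faw; have := leL a; have := level_f a; rewrite faw; lia.
move=> aw afw.
(* Only the first backward step can stay inside level 0. *)
have [|/nandP no] := boolP ((f a == w) && (l a == 0)); last first.
  apply: (tree (L - l w).+1) => // faw; rewrite lt0n.
  by case: no => //; rewrite faw eqxx.
case/andP=> /eqP<- _; apply: extend; apply: (tree (L - l a).+1) => // fga.
rewrite lt0n; apply: contraNneq (g_neq_h a) => /h_root.
by rewrite fga => ->.
Qed.

(* For [x = g v] and [v = g x] this is [g_pair_disjoint]; otherwise one of the
   two walks stops after its first directed edge. *)
Lemma reverse_darts_share_no_f_edge x v i j : dart x v -> dart v x ->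
  i <= stop x v -> j <= stop v x -> iter i f v <> iter j f x.
Proof.
wlog le_st : x v i j / stop x v <= stop v x.
  move=> H dxv dvx le_i le_j.
  case: (leqP (stop x v) (stop v x)) => [le_|/ltnW le_]; first exact: H.
  by move/esym; apply: H.
move=> dxv dvx le_i le_j.
have [st0|st_gt0] := posnP (stop x v).
  have /andP[+ _] := walk_path dvx; rewrite cons_uniq => /andP[/negP vNx _].
  move: le_i; rewrite st0 leqn0 => /eqP-> /= v_x; case: vNx.
  by apply/trajectP; exists j; rewrite ?ltnS 1?leqW.
have xg := before_lt_stop dxv st_gt0.
have vg := before_lt_stop dvx (leq_trans st_gt0 le_st).
have := stop_le x v; have := stop_le v x.
rewrite /= in xg vg; case/and3P: dxv => _ _.
rewrite {1}xg [in stop v x]xg => fxv le1 le2.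
have ggv : g (g v) = v by rewrite -xg -vg.
rewrite xg; apply/eqP; apply: g_pair_disjoint => //; rewrite -?xg; try lia.
by rewrite -xg in le1; lia.
Qed.

(** The two walks are those that enter [w] from [g w] and from [h w]; the second one stops at
    [w]. *)
Lemma two_walks_at_f_edge w : exists x v x' v',
  [/\ dart x v, dart x' v' & forall e,
    (e \in (trace (walk x v)).2) && (e \in (trace (walk x' v')).2)
    = (e == [set w; f w])].
Proof.
have adj_g : adj (g w) w by rewrite adj_sym adjE eqxx orbT.
have adj_h : adj (h w) w by rewrite adj_sym adjE eqxx !orbT.
have [x [v [i [dxv le_i iv bi]]]] := transition_covered adj_g (g_neq_f w).
have [y [u [j [dyu le_j ju bj]]]] := transition_covered adj_h (h_neq_f w).
exists x, v, y, u; split=> // e.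
apply/andP/eqP => [[/walk_edgeP e_xv /walk_edgeP e_yu]|->]; last first.
  by split; apply/walk_edgeP; right; [exists i | exists j];
     rewrite //= ?iv ?ju.
have le_xv := stop_le x v; have le_yu := stop_le y u.
have j_st : j = stop y u.
  apply/eqP; rewrite eqn_leq le_j leqNgt; apply/negP => lt_j.
  by move: (before_lt_stop dyu lt_j) (g_neq_h w); rewrite bj ju => ->; rewrite eqxx.
case: e_xv => [e_xv|[a le_a e_xv]]; case: e_yu => [e_yu|[b le_b e_yu]].
- rewrite e_xv in e_yu; case/set2_inj: e_yu => [] [xy vu]; subst x v.
    have ij : i = j by apply: (@iter_f_inj u); rewrite ?iv ?ju //; lia.
    by have := g_neq_h w; rewrite -bi -bj ij eqxx.
  by case: (reverse_darts_share_no_f_edge dxv dyu le_i le_j); rewrite iv ju.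
- by case: (@dart_not_f_edge x v (iter b f u)); rewrite // -e_xv.
- by case: (@dart_not_f_edge y u (iter a f v)); rewrite // -e_yu.
rewrite e_xv in e_yu; have ab := f_edge_inj e_yu.
have [a_i|ne_ai] := eqVneq a i; first by rewrite e_xv a_i /= iv.
have ne_bj : b != j.
  apply: contraNneq ne_ai => bj'; apply/eqP; apply: (@iter_f_inj v); try lia.
  by rewrite ab bj' ju iv.
have lt_bj : b < j by lia.
exfalso.
(* If both walks pass a common vertex before [w], they need equally many steps to [w], since
   otherwise one of them repeats [w]; but then they enter [w] from the same vertex, so
   [g w = h w]. *)
have [lt_ai|lt_ia] : a < i \/ i < a by lia.
  have di : iter (i - a) f (iter a f v) = w by rewrite -iterD subnK // ltnW.
  have dj : iter (j - b) f (iter a f v) = w by rewrite ab -iterD subnK // ltnW.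
  have [eq_d|ne_d] := eqVneq (i - a) (j - b).
    case/eqP: (g_neq_h w); rewrite -bi -bj.
    have -> : i = (i - a).-1 + a.+1 by lia.
    have -> : j = (i - a).-1 + b.+1 by lia.
    by rewrite !addnS /= !iterD ab.
  have [lt_d|lt_d] : i - a < j - b \/ j - b < i - a by lia.
    have : i - a + b = j.
      apply: (@iter_f_inj u); try lia.
      by rewrite iterD -ab di ju.
    lia.
  have : j - b + a = i.
    apply: (@iter_f_inj v); try lia.
    by rewrite iterD dj iv.
  lia.
(* Now the common vertex comes after [w] on one walk and before it on the other. So [f] leads from
   [w] back to [w], which forces level 0, and the bounds on [stop] leave one step each way:
   [f (f w) = w]. *)
have du : iter (a - i) f w = iter a f v by rewrite -iv -iterD subnK // ltnW.
have dw : iter (j - b) f (iter a f v) = w by rewrite ab -iterD subnK // ltnW.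
have lw : l w = 0.
  have := congr1 l dw; rewrite level_iter -du level_iter; lia.
have := level_iter i v; rewrite iv lw => li.
have lu : l (iter b f u) = 0 by rewrite -ab -du level_iter lw.
rewrite level_iter in lu.
have a_i : a - i = 1 by lia.
have j_b : j - b = 1 by lia.
rewrite -du a_i j_b /= in dw.
by have := f2_neq w; rewrite dw eqxx.
Qed.

(** An edge not of the form [{v, f v}] carries two opposite darts, and their walks share nothing
    else. *)
Lemma two_walks_at_edge e : e \in edges G -> exists x v x' v',
  [/\ dart x v, dart x' v' & forall e',
    (e' \in (trace (walk x v)).2) && (e' \in (trace (walk x' v')).2)
    = (e' == e)].
Proof.
case/imset2P=> x v _; rewrite inE => /andP[_ xv] ->.
have [fx|nfx] := eqVneq (f x) v; first by rewrite -fx; apply: two_walks_at_f_edge.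
have [fv|nfv] := eqVneq x (f v).
  by rewrite fv setUC; apply: two_walks_at_f_edge.
have dxv : dart x v by rewrite /dart xv nfv.
have dvx : dart v x by rewrite /dart adj_sym xv eq_sym nfx eq_sym.
exists x, v, v, x; split=> // e'.
apply/andP/eqP => [[/walk_edgeP e1 /walk_edgeP e2]|->]; last first.
  by split; apply/walk_edgeP; left; rewrite // setUC.
case: e1 => // -[i le_i e1]; case: e2 => [->|[j le_j e2]]; first exact: setUC.
rewrite e1 in e2; have := f_edge_inj e2.
by move/(reverse_darts_share_no_f_edge dxv dvx le_i le_j).
Qed.

(** Among at most 3n ordered adjacent pairs, the n pairs [(f v, v)] and the n pairs [(v, f v)] are
    disjoint by [f2_neq], and none of them is a dart. *)
Lemma card_darts : #|[set p : G * G | dart p.1 p.2]| <= #|G|.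
Proof.
pose D := [set p : G * G | dart p.1 p.2].
pose F := [set (f v, v) | v in G]; pose F' := [set (v, f v) | v in G].
pose Fg := [set (g v, v) | v in G]; pose Fh := [set (h v, v) | v in G].
have inj_F : injective (fun v => (f v, v)) by move=> u v [].
have inj_F' : injective (fun v => (v, f v)) by move=> u v [].
have DF : [disjoint D & F].
  apply/pred0P => p /=; apply/negP => /andP[Dp /imsetP[v _ def_p]].
  by move: Dp; rewrite inE def_p /dart /= eqxx andbF.
have DFF' : [disjoint D :|: F & F'].
  apply/pred0P => p /=; apply/negP => /andP[DFp /imsetP[v _ def_p]].
  move: DFp; rewrite def_p !inE.
  case/orP=> [|/imsetP[u _ [-> eq_f]]]; first by rewrite /dart /= eqxx !andbF.
  by have := f2_neq u; rewrite eq_f eqxx.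
have sub : D :|: F :|: F' \subset F :|: Fg :|: Fh.
  have adj_sub x v : adj x v -> (x, v) \in F :|: Fg :|: Fh.
    rewrite adj_sym adjE !inE => /or3P[] /eqP->; apply/orP.
    - by left; apply/orP; left; apply/imsetP; exists v.
    - by left; apply/orP; right; apply/imsetP; exists v.
    - by right; apply/imsetP; exists v.
  apply/subsetP => -[x v] /setUP[/setUP[]|].
  - by rewrite inE => /and3P[/= xv _ _]; apply: adj_sub.
  - by case/imsetP=> u _ [-> ->]; apply: adj_sub; rewrite adj_sym adj_f.
  - by case/imsetP=> u _ [-> ->]; apply: adj_sub; rewrite adj_f.
have cardF : #|F| = #|G| := card_imset _ inj_F.
have cardF' : #|F'| = #|G| := card_imset _ inj_F'.
have cardFg : #|Fg| <= #|G| := leq_imset_card _ _.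
have cardFh : #|Fh| <= #|G| := leq_imset_card _ _.
have := subset_leq_card sub.
rewrite (cardsU (D :|: F)) (cardsU D).
move: DF DFF'; rewrite -!setI_eq0 => /eqP-> /eqP->; rewrite cards0 !subn0.
have := (leq_card_setU (F :|: Fg) Fh).1; have := (leq_card_setU F Fg).1.
move=> /= leU leU' le_sub.
rewrite -/D; move: leU leU' le_sub cardFg cardFh; rewrite cardF cardF'.
move: #|F :|: Fg| #|F :|: Fg :|: Fh| #|Fg| #|Fh| #|D| #|G|; lia.
Qed.

Lemma ssp_le_card : ssp G <= #|G|.
Proof.
pose P := [set trace (walk p.1 p.2) | p in [set p : G * G | dart p.1 p.2]].
have inP x v : dart x v -> trace (walk x v) \in P.
  by move=> dxv; apply/imsetP; exists (x, v); rewrite ?inE.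
suff sepP : strongly_separating P.
  apply: leq_trans (ssp_leq sepP) _.
  by apply: leq_trans (leq_imset_card _ _) card_darts.
apply/andP; split.
  apply/forall_inP => H /imsetP[p]; rewrite inE => dp ->.
  by apply/is_pathP; exists (walk p.1 p.2); split=> //; apply: walk_path.
(* As [e] is the only common edge of two walks, one of the two avoids [e']. *)
have one e e' : e \in edges G -> e != e' ->
    [exists H in P, (e \in H.2) && (e' \notin H.2)].
  case/two_walks_at_edge=> x [v [x' [v' [d1 d2 Hw]]]] ne.
  have := Hw e; rewrite eqxx => /andP[in1 in2].
  have := Hw e'; rewrite eq_sym (negbTE ne) => /negbT/nandP[out|out].
    by apply/existsP; exists (trace (walk x v)); rewrite inP // in1.
  by apply/existsP; exists (trace (walk x' v')); rewrite inP // in2.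
apply/forall_inP => e eG; apply/forall_inP => e' e'G; apply/implyP => ne.
by rewrite /separated !one // eq_sym.
Qed.

End Walks.

(** * Assigning each edge to one of its ends in a graph of maximum degree 2 *)

(* The special vertex [t], which chooses nothing, makes the induction work:
   after deleting a vertex [v], one neighbour of [v] has to choose [v] and
   becomes the new special vertex. *)
Lemma edge_choice (T : finType) (e : rel T) (A : {set T}) (t : T) :
  symmetric e -> irreflexive e ->
  (forall x, x \in A -> #|[set y in A | e x y]| <= 2) ->
  (t \in A -> #|[set y in A | e t y]| <= 1) ->
  exists p : T -> T, forall x y, x \in A -> y \in A -> e x y ->
    (x != t /\ p x = y) \/ (y != t /\ p y = x).
Proof.
move=> e_sym e_irr; have [n] := ubnP #|A|.
elim: n A t => // n IHn A t lt_A deg2 deg1.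
have [A0|[v0 v0A]] := set_0Vmem A.
  by exists id => x y; rewrite A0 inE.
(* Delete [t] itself when it lies in [A]. Here [a] is the neighbour that [v] chooses and [b] the one
   that must choose [v]; [v] serves as a dummy for a missing neighbour. *)
have [v [vA vt [a [b [bN ab]]]]] : exists v, [/\ v \in A, (t \in A -> v = t) &
    exists a b, (b = v \/ b \in [set y in A | e v y]) /\
      forall y, y \in A -> e v y -> y = b \/ (v != t /\ y = a)].
  exists (if t \in A then t else v0); split; [by case: ifP | by move->|].
  set v := if _ then _ else _.
  have vA : v \in A by rewrite /v; case: ifP.
  set N := [set y in A | e v y].
  have inN y : y \in A -> e v y -> y \in N by rewrite inE => -> ->.
  have [N0|[b bN]] := set_0Vmem N.
    exists v, v; split; first by left.
    by move=> y yA vy; have := inN y yA vy; rewrite N0 inE.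
  have [Nb0|[a aN]] := set_0Vmem (N :\ b).
    exists v, b; split; first by right.
    move=> y yA vy; left; apply/eqP; have := inN y yA vy.
    by apply: contraLR => ny; have := in_set0 y; rewrite -Nb0 in_setD1 ny /= => ->.
  exists a, b; split; first by right.
  have cardN : #|N| = (#|N :\ b|).+1 by rewrite (cardsD1 b N) bN.
  have Nb_gt0 : 0 < #|N :\ b| by apply/card_gt0P; exists a.
  have Nb1 : {in N :\ b &, forall x, all_equal_to x}.
    by apply/card_le1_eqP; have := deg2 v vA; rewrite -/N cardN.
  have vt : v != t.
    apply: contraTneq Nb_gt0 => vt; have := deg1; rewrite -vt -/N cardN => /(_ vA).
    by rewrite -leqNgt.
  move=> y yA vy; have [->|ny] := eqVneq y b; [by left | right; split=> //].
  by apply: Nb1 => //; rewrite in_setD1 ny inN.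
have subN x : [set y in A :\ v | e x y] \subset [set y in A | e x y].
  by apply/subsetP=> y; rewrite !inE => /andP[/andP[_ ->] ->].
have [||bA|p Hp] := IHn (A :\ v) b.
- by move: lt_A; rewrite (cardsD1 v A) vA.
- move=> x /setD1P[_ xA]; apply: leq_trans (deg2 x xA).
  exact: subset_leq_card.
- move: bA bN; rewrite !inE => /andP[nbv bA] [bv|/andP[_ vb]].
    by rewrite bv eqxx in nbv.
  have := deg2 b bA; rewrite (cardsD1 v [set y in A | e b y]) inE vA e_sym vb.
  rewrite add1n ltnS; apply: leq_trans.
  by apply: subset_leq_card; apply/subsetP => y; rewrite !inE -andbA.
have edge_at_v y : y \in A -> e v y ->
    (v != t /\ (if v == v then a else v) = y) \/
    (y != t /\ (if y == v then a else if y == b then v else p y) = v).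
  move=> yA vy; have nyv : y != v by apply: contraTneq vy => ->; rewrite e_irr.
  rewrite eqxx (negbTE nyv); case: (ab y yA vy) => [->|[nvt ->]]; last by left.
  right; rewrite eqxx; split=> //; have [tA|tNA] := boolP (t \in A).
    by rewrite -(vt tA) -(_ : y = b) //; case: (ab y yA vy) => [//|[/eqP[]]]; exact: vt.
  by apply: contraNneq tNA => <-; case: bN => [->|] //; rewrite inE => /andP[].
exists (fun x => if x == v then a else if x == b then v else p x) => x y xA yA xy.
have [xv|nxv] := eqVneq x v.
  by move: xy; rewrite xv => vy; case: (edge_at_v y yA vy) => [] []; rewrite ?eqxx; auto.
have [yv|nyv] := eqVneq y v.
  move: xy; rewrite yv e_sym => vx.
  by case: (edge_at_v x xA vx) => [] []; rewrite ?eqxx ?(negbTE nxv); auto.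
have not_t z : z \in A -> z != v -> z != t.
  by move=> zA; apply: contraNneq => zt; rewrite vt -zt.
have := Hp x y; rewrite !in_setD1 nxv nyv xA yA => /(_ isT isT xy).
by case=> [] [/negbTE-> ->]; [left | right]; rewrite not_t.
Qed.

(** * Neighbourhoods, distances and long cycles in cubic graphs *)

Section Cubic.

Variables (G : sgraph) (cubic_G : cubic G).

Lemma third_neighbor v a b : adj v a -> adj v b -> a != b ->
  exists c : G, [/\ c != a, c != b &
    forall y, adj v y = [|| y == a, y == b | y == c]].
Proof.
move=> va vb ab; have := cubic_G v; rewrite /degree; set N := [set y | _] => cN.
have : #|N :\ a :\ b| == 1.
  have := cN; rewrite (cardsD1 a N) inE va (cardsD1 b (N :\ a)).
  by rewrite !inE vb eq_sym ab; lia.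
case/cards1P=> c Nc; have : c \in N :\ a :\ b by rewrite Nc set11.
rewrite !inE => /and3P[cb ca vc]; exists c; split=> // y.
apply/idP/or3P => [vy|[]/eqP-> //].
have [|ya] := eqVneq y a; first by constructor.
have [|yb] := eqVneq y b; first by constructor.
by constructor 3; rewrite -in_set1 -Nc !inE yb ya.
Qed.

Lemma second_neighbor (v a : G) : exists b, adj v b /\ b != a.
Proof.
have := cubic_G v; rewrite /degree; set N := [set y | _] => cN.
have : 0 < #|N :\ a| by move: cN; rewrite (cardsD1 a N); lia.
by case/card_gt0P=> b; rewrite !inE => /andP[nb vb]; exists b.
Qed.

Hypothesis connected_G : connected G.

(** The clique uses up the degree of its vertices, so no edge leaves it, and by connectedness it is
    the whole graph. *)
Lemma clique4_isomorphic (S : {set G}) : #|S| = 4 ->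
  {in S &, forall x y, x != y -> adj x y} -> isomorphic G (complete 4).
Proof.
move=> cS cliqueS.
have N_S x : x \in S -> [set y | adj x y] = S :\ x.
  move=> xS; apply/esym/eqP; rewrite eqEcard; apply/andP; split.
    by apply/subsetP=> y; rewrite !inE => /andP[yx yS]; rewrite cliqueS // eq_sym.
  by have := cubic_G x; rewrite /degree => ->; move: cS; rewrite (cardsD1 x S) xS; lia.
have [x0 x0S] : exists x, x \in S by apply/card_gt0P; rewrite cS.
have allS x : x \in S.
  case: connected_G => _ /(_ x0 x) /connectP[q path_q ->].
  elim: q (x0) x0S path_q => //= y q IHq z zS /andP[zy path_q].
  have : y \in [set y | adj z y] by rewrite inE.
  by rewrite N_S // => /setD1P[_ yS]; apply: IHq path_q.
have cG : #|G| = 4 by rewrite -cS; apply: eq_card => x; rewrite allS.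
exists (fun x => cast_ord cG (enum_rank x)).
  exists (fun i => enum_val (cast_ord (esym cG) i)) => x.
    by rewrite cast_ordK enum_rankK.
  by rewrite enum_valK cast_ordKV.
move=> x y /=; rewrite (inj_eq (@cast_ord_inj _ _ _)) (inj_eq enum_rank_inj).
by have := N_S x (allS x) => /setP/(_ y); rewrite !inE allS andbT eq_sym => ->.
Qed.

(** Take for [l] the distance to [C], as the index of the first ball around [C] that contains the
    vertex. *)
Lemma distance_to (C : {set G}) : C != set0 -> exists l : G -> nat,
  [/\ forall v, (l v == 0) = (v \in C),
      forall v y, adj v y -> l v <= (l y).+1 &
      forall v, 0 < l v -> exists y, adj v y /\ l y = (l v).-1].
Proof.
case/set0Pn=> c cC.
pose ball n := iter n (fun S => S :|: [set y | [exists x in S, adj x y]]) C.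
have ballS n x y : x \in ball n -> adj x y -> y \in ball n.+1.
  by move=> xB xy; rewrite /= !inE; apply/orP; right; apply/existsP; exists x; rewrite xB.
have ball_ex v : exists n, v \in ball n.
  case: connected_G => _ /(_ c v) /connectP[q path_q ->].
  have : c \in ball 0 by [].
  elim: q (c) 0 path_q => [|y q IHq] z n /=; first by move=> _ zB; exists n.
  by case/andP=> zy path_q zB; apply: IHq path_q (ballS _ _ _ zB zy).
pose l v := ex_minn (ball_ex v).
have l_in v : v \in ball (l v) by rewrite /l; case: ex_minnP.
have l_min v n : v \in ball n -> l v <= n by rewrite /l; case: ex_minnP => m _; apply.
exists l; split=> [v|v y vy|v].
- apply/eqP/idP => [l0|vC]; first by have := l_in v; rewrite l0.
  by apply/eqP; rewrite -leqn0; apply: l_min.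
- by apply: l_min; apply: ballS (l_in y) _; rewrite adj_sym.
case lv: (l v) => [//|n] _; have := l_in v; rewrite lv /= !inE => /orP[vB|].
  by have := l_min v n vB; rewrite lv ltnn.
case/existsP=> y /andP[yB yv]; exists y; rewrite adj_sym yv; split=> //.
apply/eqP; rewrite eqn_leq (l_min _ _ yB) /= -ltnS -lv.
by apply: l_min; apply: ballS (l_in y) yv.
Qed.

Lemma iter_next_neq (s : seq G) (x : G) (k : nat) :
  uniq s -> x \in s -> 0 < k < size s -> iter k (next s) x != x.
Proof.
move=> us xs; case: (rot_to xs) => i s' rot_s.
have us' : uniq (x :: s') by rewrite -rot_s rot_uniq.
rewrite -(size_rot i s) rot_s => /andP[k_gt0 lt_k].
have iterE m : m < size (x :: s') -> iter m (next s) x = nth x (x :: s') m.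
  elim: m => // m IHm lt_m; rewrite iterS IHm 1?ltnW // -(next_rot i us) rot_s.
  by rewrite next_nth mem_nth 1?ltnW // index_uniq // ltnW.
rewrite iterE //; apply: contraTneq k_gt0 => eq_x.
by rewrite -leqNgt leqn0 -(@nth_uniq _ x (x :: s') k 0) //= eq_x.
Qed.

(** All neighbours of the end [x] of a longest path lie on that path. Closing it at the farthest
    one, [y], gives a cycle through all three. *)
Lemma long_cycle : (forall x y z : G, adj x y -> adj y z -> ~~ adj x z) ->
  exists s : seq G, [/\ uniq s, cycle (@adj G) s & 5 <= size s].
Proof.
move=> no_triangle; have [/card_gt0P[v0 _] _] := connected_G.
pose P n := [exists s : n.-tuple G, @simple_path G s].
have P_of (s : seq G) : simple_path s -> P (size s).
  by move=> ps; apply/existsP; exists (in_tuple s).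
have exP : exists n, P n by exists 1; apply: (P_of [:: v0]).
have maxP n : P n -> n <= #|G|.
  case/existsP=> s /andP[us _]; rewrite -(size_tuple s) -(card_uniqP us).
  exact: max_card.
case: (ex_maxnP exP maxP) => n /existsP[[s /= /eqP size_s] ps] max_n.
have n_gt0 : 0 < n by apply: max_n; apply: (P_of [:: v0]).
case: s size_s ps => [|x s] size_s ps; first by rewrite -size_s in n_gt0.
have [+ path_s] := andP ps; rewrite cons_uniq => /andP[xNs us].
have in_s y : adj x y -> y \in s.
  move=> xy; have yx : y != x by apply: contraTneq xy => ->; rewrite adj_irrefl.
  apply: contraT => yNs; have : simple_path [:: y, x & s].
    apply/andP; split; first by rewrite !cons_uniq xNs us inE negb_or yx yNs.
    by rewrite /= adj_sym xy.
  by move/P_of/max_n; rewrite /= in size_s; rewrite /= size_s ltnn.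
have [y0 [xy0 _]] := second_neighbor x x.
pose N := [set y | adj x y].
have cN : #|N| = 3 := cubic_G x.
case: (@arg_maxnP _ y0 (adj x) (fun y => index y s) xy0) => y xy max_y.
have ys := in_s y xy.
pose t := take (index y s).+1 s.
have lt_y : index y s < size s by rewrite index_mem.
have size_t : size t = (index y s).+1 by rewrite size_takel.
have last_t : last x t = y by rewrite /t (take_nth x lt_y) last_rcons nth_index.
have in_t z : adj x z -> z \in t.
  by move=> xz; rewrite in_take ?in_s // ltnS; apply: max_y.
have ut : uniq (x :: t).
  by rewrite /= (contraNN _ xNs) ?take_uniq //; apply: mem_take.
have path_t : path (@adj G) x t by apply: take_path.
exists (x :: t); split=> //=.
  by rewrite rcons_path path_t last_t adj_sym.
(* With at most four vertices on the cycle, [t] would consist of the three neighbours of [x], and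
   its first two would form a triangle with [x]. *)
rewrite ltnNge; apply/negP => lt_t.
have size_N : size (enum N) = 3 by rewrite -cardE.
have subNt : {subset enum N <= t} by move=> z; rewrite mem_enum inE; apply: in_t.
have [|] := uniq_min_size (enum_uniq N) subNt; first by rewrite size_N.
rewrite size_N => st eq_t; clear in_t subNt last_t.
case: t st path_t eq_t {ut size_t lt_t} => [|a [|b [|c [|]]]] //= _ /and4P[xa ab _ _] eq_t.
have : b \in enum N by rewrite eq_t !inE eqxx orbT.
by rewrite mem_enum inE; apply/negP/(no_triangle _ _ _ xa ab).
Qed.

End Cubic.

(** * Choosing [h] and [g] so that the conditions on the walks hold *)

Section Choice.

Variables (G : sgraph) (f : G -> G) (l : G -> nat).

(** A leaf of the functional graph of [f], not a vertex of degree 1. *)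
Definition leaf (v : G) : bool := [forall u, f u != v].

(* [x] is a neighbour of the leaf [v] from which no walk may both start and
   continue past [f v]. *)
Definition tied (v x : G) : bool :=
  [&& adj v x, x != f v, l v == 1 &
      [|| x == f (f v), x == f (f (f v)) | (l x == 0) && (f x == f v)]].

Hypothesis cubic_G : cubic G.
Hypothesis adj_f : forall v, adj v (f v).
Hypothesis f2_neq : forall v, f (f v) != v.
Hypothesis level_f : forall v, l (f v) = (l v).-1.
Hypothesis level_adj : forall v y, adj v y -> l v <= (l y).+1.
Hypothesis root_pred : forall v, l v = 0 -> exists u, l u = 0 /\ f u = v.
Hypothesis root_inj : forall u v, l u = 0 -> l v = 0 -> f u = f v -> u = v.
Hypothesis no_chord : forall v, l v = 0 -> adj v (f (f v)) -> f (f (f v)) = v.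
Hypothesis tied_uniq : forall v x y, tied v x -> tied v y -> x = y.
Variable p : G -> G.
Hypothesis p_covers : forall v y, leaf v -> leaf y -> adj v y ->
  ((forall x, ~~ tied v x) /\ p v = y) \/ ((forall x, ~~ tied y x) /\ p y = v).

Lemma leaf_level v : leaf v -> 0 < l v.
Proof.
move=> /forallP lv; rewrite lt0n; apply/eqP => /root_pred[u [_ fu]].
by have := lv u; rewrite fu eqxx.
Qed.

(** This [y] becomes [h v]: the predecessor on the cycle at level 0, the tied neighbour or else
    [p v] at a leaf, and elsewhere a neighbour that is not a preimage of [v], if possible, so that a
    preimage is left for [g v]. *)
Lemma second_edge v : exists y,
  [/\ adj v y, y != f v & l v = 0 -> l y = 0 /\ f y = v] /\
  [/\ 0 < l v -> ~~ leaf v ->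
        (exists z, [/\ adj v z, z != f v & f z != v]) -> f y != v,
      (forall x, leaf v -> tied v x -> y = x) &
      leaf v -> (forall x, ~~ tied v x) -> adj v (p v) -> p v != f v -> y = p v].
Proof.
have [y0 [vy0 y0f]] := second_neighbor cubic_G v (f v).
have [l0|l_gt0] := posnP (l v).
  have [u [lu fu]] := root_pred l0.
  have not_leaf : leaf v -> False by move/leaf_level; rewrite l0.
  exists u; split; split=> //; try by move=> *; case: not_leaf.
  - by rewrite adj_sym -fu.
  - by rewrite -fu eq_sym f2_neq.
have no_root (P : Prop) : l v = 0 -> P by move=> l0; rewrite l0 in l_gt0.
have [lv|nlv] := boolP (leaf v); last first.
  have [z /and3P[vz zf fz]|none] := pickP (fun z => [&& adj v z, z != f v & f z != v]).
    by exists z; split; split=> //; apply: no_root.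
  exists y0; split; split=> //; first exact: no_root.
  by move=> _ _ [z [vz zf fz]]; have := none z; rewrite vz zf fz.
have [x tx|no_tied] := pickP (tied v).
  exists x; have /and4P[vx xf _ _] := tx; split; split=> //.
  - exact: no_root.
  - by move=> y _; apply: tied_uniq.
  - by move=> _ /(_ x); rewrite tx.
have [|no_p] := boolP (adj v (p v) && (p v != f v)).
  case/andP=> vp pf; exists (p v); split; split=> //; first exact: no_root.
  by move=> x _; rewrite no_tied.
exists y0; split; split=> //; first exact: no_root.
- by move=> x _; rewrite no_tied.
- by move=> _ _ vp pf; rewrite vp pf in no_p.
Qed.

Lemma ssp_le_card_of_choice : ssp G <= #|G|.
Proof.
have [h hP] := fin_all_exists second_edge.
have adj_h v : adj v (h v) by case: (hP v) => -[].
have h_neq_f v : h v != f v by case: (hP v) => -[].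
have third v : exists c, [/\ c != f v, c != h v &
    forall y, adj v y = [|| y == f v, y == c | y == h v]].
  have fh : f v != h v by rewrite eq_sym.
  have [c [cf ch cE]] := third_neighbor cubic_G (adj_f v) (adj_h v) fh.
  by exists c; split=> // y; rewrite cE; congr (_ || _); rewrite orbC.
have [g gP] := fin_all_exists third.
have g_neq_f v : g v != f v by case: (gP v).
have g_neq_h v : g v != h v by case: (gP v).
have adjE v y : adj v y = [|| y == f v, y == g v | y == h v] by case: (gP v).
have adj_g v : adj v (g v) by rewrite adjE eqxx orbT.
have h_root v : l v = 0 -> h (f v) = v.
  move=> lv; have lfv : l (f v) = 0 by rewrite level_f lv.
  by case: (hP (f v)) => -[_ _ /(_ lfv)[lh fh]] _; apply: root_inj.
have h_tied v x : leaf v -> tied v x -> h v = x.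
  by case: (hP v) => _ [_ hx _] lv; apply: hx.
(* Above level 0, if [g v] is not a preimage of [v], then by its choice [h v] is not one either, so
   [v] has none. *)
have root_or_leaf v : f (g v) != v -> l v = 0 \/ leaf v.
  move=> fgv; case: (posnP (l v)) => [|l_gt0]; [by left | right].
  apply: contraT => nlv; have := nlv; rewrite negb_forall => /existsP[u].
  rewrite negbK => /eqP fu.
  have hv : f (h v) != v.
    by case: (hP v) => _ [hn _ _]; apply: hn => //; exists (g v).
  have : adj v u by rewrite adj_sym -fu adj_f.
  rewrite adjE => /or3P[] /eqP uE.
  - by have := f2_neq v; rewrite -uE fu eqxx.
  - by rewrite -uE fu eqxx in fgv.
  - by rewrite -uE fu eqxx in hv.
(* Here [l v = 1], so only three vertices from [v] meet two from [g v]. A coincidence contradicts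
   the levels, [g v != f v] or injectivity at level 0, or else makes [g v] tied to [v] and hence
   equal to [h v]. *)
have leaf_root v i j : leaf v -> l (g v) = 0 -> f (g v) != v ->
    i <= (l v).+1 -> j <= (l (g v)).+1 -> iter i f v != iter j f (g v).
  move=> lv lx fx; rewrite lx => le_i le_j; apply/negP => /eqP eq_ij.
  have l1 : l v = 1.
    by have := level_adj (adj_g v); have := leaf_level lv; rewrite lx; lia.
  have fv0 : l (f v) = 0 by rewrite level_f l1.
  have not_tied : ~~ tied v (g v).
    by apply/negP => /(h_tied _ _ lv) hg; have := g_neq_h v; rewrite hg eqxx.
  move: not_tied; rewrite /tied adj_g g_neq_f l1 lx !eqxx /= !negb_or.
  case/and3P=> /eqP n1 /eqP n2 /eqP n3; rewrite l1 in le_i.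
  case: i le_i eq_ij => [|[|[|]]] //= _; case: j le_j => [|[|]] //= _ eq_ij.
  - by rewrite eq_ij lx in l1.
  - by rewrite eq_ij level_f lx in l1.
  - by have := g_neq_f v; rewrite eq_ij eqxx.
  - by case: n3.
  - by case: n1.
  - by have := root_inj fv0 lx eq_ij => eq_g; have := g_neq_f v; rewrite -eq_g eqxx.
apply: (@ssp_le_card G f g h l) => //.
(* At level 0 this would be a chord, with [f (g v) = v]. At a leaf the levels force [l v = 1], and
   [g v] would be tied. *)
- move=> v b fgv; case/andP=> b_gt1 le_b; apply/negP => /eqP itb.
  case: (root_or_leaf v fgv) => [lv|lv].
    have b2 : b = 2 by lia.
    move: itb; rewrite b2 /= => fg; have := adj_g v; rewrite -fg.
    by move/(no_chord lv) => f3; rewrite -fg f3 eqxx in fgv.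
  have := level_adj (adj_g v); have := leaf_level lv.
  have lit n u : l (iter n f u) = l u - n.
    by elim: n => [|n IHn]; rewrite ?subn0 //= level_f IHn subnS.
  rewrite -itb lit => l_gt0 le_l; have l1 : l v = 1 by lia.
  have tg : tied v (g v).
    rewrite /tied adj_g g_neq_f l1 /= -itb.
    rewrite l1 in le_b.
    by case: b b_gt1 le_b {itb le_l} => [|[|[|[|]]]] //= _ _; rewrite eqxx ?orbT.
  by have := g_neq_h v; rewrite (h_tied _ _ lv tg) eqxx.
move=> v i j fgv ggv le_i le_j.
have fv : f (g (g v)) != g v by rewrite ggv eq_sym.
case: (root_or_leaf v fgv) (root_or_leaf (g v) fv) => [lv|lv] [lx|lx].
- rewrite lv in le_i; rewrite lx in le_j; apply/eqP => eq_ij.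
  case: i le_i eq_ij => [|[|]] //= _; case: j le_j => [|[|]] //= _ eq_ij.
  + by have := adj_g v; rewrite -eq_ij adj_irrefl.
  + by rewrite -eq_ij eqxx in fgv.
  + by have := g_neq_f v; rewrite eq_ij eqxx.
  + by have := adj_g v; rewrite -(root_inj lv lx eq_ij) adj_irrefl.
- rewrite eq_sym -{2}ggv; apply: leaf_root => //; rewrite ?ggv //.
- exact: leaf_root.
(* Of two adjacent leaves, one has the other as its [h], so they cannot be each other's [g]. *)
have pick_gives y z : leaf y -> (forall x, ~~ tied y x) -> p y = z -> z = g y -> False.
  move=> ly ny py zg; have := g_neq_h y; case: (hP y) => _ [_ _ ->] //;
    by rewrite py zg ?eqxx ?adj_g ?g_neq_f.
case: (p_covers lv lx (adj_g v)) => [[nt pv]|[nt pv]].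
  by case: (pick_gives v (g v)).
by case: (pick_gives (g v) v).
Qed.

End Choice.

(** * Rooting at a cycle, without triangles and with a triangle *)

Section Cases.

Variables (G : sgraph) (cubic_G : cubic G) (connected_G : connected G).

(** No [f v] is a leaf, so a vertex has at most two leaf neighbours, and a leaf [t] has at most
    one. *)
Lemma leaf_choice (f : G -> G) (t : G) : (forall v, adj v (f v)) ->
  (leaf f t -> exists x, [/\ adj t x, x != f t & ~~ leaf f x]) ->
  exists p : G -> G, forall v y, leaf f v -> leaf f y -> adj v y ->
    (v != t /\ p v = y) \/ (y != t /\ p y = v).
Proof.
move=> adj_f t_nbr; pose A := [set v | leaf f v].
have fNleaf v : ~~ leaf f (f v) by apply/forallPn; exists v; rewrite negbK.
have card_N v : #|[set y | adj v y] :\ f v| = 2.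
  by have := cubic_G v; rewrite /degree (cardsD1 (f v)) inE adj_f; lia.
have sub_N v : [set y in A | adj v y] \subset [set y | adj v y] :\ f v.
  apply/subsetP=> y; rewrite !inE => /andP[ly ->]; rewrite andbT.
  by apply: contraTneq ly => ->.
have [||p pP] := @edge_choice G (@adj G) A t (@adj_sym G) (@adj_irrefl G).
- by move=> x _; rewrite -(card_N x); apply: subset_leq_card.
- rewrite inE => /t_nbr[x [tx xf nlx]]; rewrite -ltnS -(card_N t).
  apply/proper_card/properP; split=> //; exists x; first by rewrite !inE xf.
  by rewrite !inE (negbTE nlx).
by exists p => v y lv ly; apply: pP; rewrite inE.
Qed.

Lemma rooted_choice (s : seq G) :
  uniq s -> cycle (@adj G) s -> 3 <= size s -> exists (f : G -> G) (l : G -> nat),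
  [/\ forall v, adj v (f v), forall v, f (f v) != v,
      forall v, l (f v) = (l v).-1 & forall v y, adj v y -> l v <= (l y).+1] /\
  [/\ forall v, (l v == 0) = (v \in s), {in s, f =1 next s} &
      forall v, l v = 1 -> adj v (f (f (f v))) ->
        forall z, z \in s -> adj v z -> adj v (f (f z))].
Proof.
move=> us cyc_s size_s; pose n := next s.
have s_neq0 : [set x in s] != set0.
  by case: s size_s {us cyc_s n} => // x s _; apply/set0Pn; exists x; rewrite !inE eqxx.
have [l [l0 level_adj l_pred]] := distance_to connected_G s_neq0.
have {}l0 v : (l v == 0) = (v \in s) by rewrite l0 inE.
have l_s v : v \in s -> l v = 0 by rewrite -l0 => /eqP.
have s_l v : l v = 0 -> v \in s by rewrite -l0 => ->.
have ex_f v : exists y, [/\ adj v y, v \in s -> y = n v,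
    0 < l v -> l y = (l v).-1 & l v = 1 -> adj v (n (n y)) ->
    forall z, z \in s -> adj v z -> adj v (n (n z))].
  have [vs|vNs] := boolP (v \in s).
    exists (n v); split=> //; first exact: next_cycle.
    - by rewrite l_s.
    - by rewrite l_s.
  have l_gt0 : 0 < l v by rewrite lt0n l0.
  have [y [vy ly]] := l_pred v l_gt0.
  (* At level 1, prefer as [f v] a cycle neighbour whose second successor is not adjacent to [v]; if
     there is none, the last clause holds for every [z]. *)
  have [z /and3P[zs vz nz]|none] :=
    pickP (fun z => [&& z \in s, adj v z & ~~ adj v (n (n z))]).
    have [lv1|nlv1] := eqVneq (l v) 1.
      exists z; split=> //.
      - by rewrite lv1 l_s.
      - by rewrite (negbTE nz).
    exists y; split=> //.
    by move/eqP; rewrite (negbTE nlv1).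
  exists y; split=> //.
  by move=> _ _ z zs vz; have := none z; rewrite zs vz => /negbFE.
have [f fP] := fin_all_exists ex_f.
have f_next v : v \in s -> f v = n v by case: (fP v).
have f_s v : v \in s -> f v \in s by move=> vs; rewrite f_next // mem_next.
have level_f v : l (f v) = (l v).-1.
  have [lv|l_gt0] := posnP (l v); last by case: (fP v) => _ _ ->.
  by rewrite lv l_s // f_s // s_l.
have f2_neq v : f (f v) != v.
  have [vs|vNs] := boolP (v \in s).
    rewrite (f_next (f v)) ?f_s // f_next //.
    by apply: (@iter_next_neq _ s v 2) => //; rewrite (leq_trans _ size_s).
  apply: contraNneq vNs => ffv; rewrite -l0.
  have := level_f (f v); rewrite ffv level_f; lia.
exists f, l; split; split=> //; first by move=> v; case: (fP v).
move=> v lv; have fvs : f v \in s by apply: s_l; rewrite level_f lv.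
rewrite (f_next _ (f_s _ fvs)) (f_next _ fvs) => vnn z zs vz.
rewrite (f_next _ (f_s _ zs)) (f_next _ zs).
by case: (fP v) => _ _ _; apply.
Qed.

(** This isolates what depends on the cycle: its chords, the uniqueness of tied neighbours and the
    choice between adjacent leaves. *)
Lemma ssp_le_card_of_cycle (s : seq G) :
  uniq s -> cycle (@adj G) s -> 3 <= size s ->
  (forall (f : G -> G) (l : G -> nat),
    (forall v, adj v (f v)) -> (forall v, f (f v) != v) ->
    (forall v, l (f v) = (l v).-1) ->
    (forall v, (l v == 0) = (v \in s)) -> {in s, f =1 next s} ->
    (forall v, l v = 1 -> adj v (f (f (f v))) ->
      forall z, z \in s -> adj v z -> adj v (f (f z))) ->
    [/\ forall v, v \in s -> adj v (f (f v)) -> f (f (f v)) = v,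
        forall v x y, tied f l v x -> tied f l v y -> x = y &
        exists p : G -> G, forall v y, leaf f v -> leaf f y -> adj v y ->
          ((forall x, ~~ tied f l v x) /\ p v = y) \/
          ((forall x, ~~ tied f l y x) /\ p y = v)]) ->
  ssp G <= #|G|.
Proof.
move=> us cyc_s size_s H.
have [f [l [[adj_f f2_neq level_f level_adj] [l0 f_next spread]]]] :=
  rooted_choice us cyc_s size_s.
have [no_chord tied_uniq [p pP]] := H f l adj_f f2_neq level_f l0 f_next spread.
have s_l v : l v = 0 -> v \in s by rewrite -l0 => ->.
apply: (@ssp_le_card_of_choice G f l) pP => //.
- move=> v /s_l vs; exists (prev s v); have ps : prev s v \in s by rewrite mem_prev.
  by rewrite f_next // next_prev //; split=> //; apply/eqP; rewrite l0.
- move=> u v /s_l us' /s_l vs; rewrite !f_next // => eq_n.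
  by rewrite -(prev_next us u) eq_n prev_next.
- by move=> v /s_l; apply: no_chord.
Qed.

Lemma ssp_le_card_triangle_free :
  (forall x y z : G, adj x y -> adj y z -> ~~ adj x z) -> ssp G <= #|G|.
Proof.
move=> no_triangle.
have [s [us cyc_s size_s]] := long_cycle cubic_G connected_G no_triangle.
apply: (ssp_le_card_of_cycle us cyc_s); first exact: leq_trans size_s.
move=> f l adj_f f2_neq level_f l0 f_next spread.
have no_chord v : ~~ adj v (f (f v)) by apply: no_triangle (adj_f _).
have f_s v : v \in s -> f v \in s by move=> vs; rewrite f_next // mem_next.
have tied_f3 v x : tied f l v x -> x = f (f (f v)) /\ l v = 1.
  case/and4P=> vx xf /eqP lv /or3P[/eqP xE|/eqP xE|/andP[_ /eqP fx]] //.
    by have := no_chord v; rewrite -xE vx.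
  by have /negP[] := no_triangle _ _ _ vx (adj_f x); rewrite fx adj_f.
split.
- by move=> v _; rewrite (negbTE (no_chord v)).
- by move=> v x y /tied_f3[-> _] /tied_f3[->].
have [v0 v0P] : exists t, ~~ leaf f t.
  have [/card_gt0P[v _] _] := connected_G; exists (f v).
  by apply/forallPn; exists v; rewrite negbK.
have [|p pP] := @leaf_choice f v0 adj_f; first by rewrite (negbTE v0P).
exists p => v y lv ly vy.
(* Besides [c = f u] and [x = f (f c)], the choice of [f] makes [f (f x)] a neighbour of [u], and it
   differs from [c] because the cycle has at least 5 vertices. So all neighbours of [u] lie on the
   cycle and have preimages. *)
have tied_no_leaf u z x : leaf f z -> adj u z -> ~~ tied f l u x.
  move=> lz uz; apply/negP => tx; have [xE lu] := tied_f3 _ _ tx.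
  have /and4P[ux _ _ _] := tx.
  set c := f u in xE; have cs : c \in s by rewrite -l0 level_f lu.
  have iter_f k : iter k f c = iter k (next s) c.
    have inS m : iter m f c \in s by elim: m => //= m; apply: f_s.
    by elim: k => //= k IHk; rewrite f_next ?inS // IHk.
  have f4c : f (f (f (f c))) != c.
    by have /= -> := iter_f 4; apply: (@iter_next_neq _ s c 4).
  have c_x : c != x by rewrite xE eq_sym f2_neq.
  have uffx : adj u (f (f x)).
    apply: (spread u lu) => //; first by rewrite -/c -xE.
    by rewrite xE; apply/f_s/f_s.
  have [d [_ _ adj_u]] := third_neighbor cubic_G (adj_f u) ux c_x.
  have zs : z \in s.
    have dE : f (f x) = d.
      move: uffx; rewrite adj_u xE (negbTE (f2_neq _)) -/c (negbTE f4c) /=.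
      by move/eqP.
    move: uz; rewrite adj_u => /or3P[] /eqP-> //; first by rewrite xE; apply/f_s/f_s.
    by rewrite -dE xE; do 4!apply/f_s.
  have /forallP/(_ (prev s z)) := lz.
  by rewrite f_next ?mem_prev // next_prev // eqxx.
case: (pP v y lv ly vy) => [] [_ pE]; [left | right]; split=> // x.
  exact: tied_no_leaf vy.
by apply: tied_no_leaf lv _; rewrite adj_sym.
Qed.

Lemma ssp_le_card_triangle (x y z : G) : ~ isomorphic G (complete 4) ->
  adj x y -> adj y z -> adj x z -> ssp G <= #|G|.
Proof.
move=> not_K4 xy yz xz.
have neq a b : adj a b -> a != b :> G.
  by apply: contraTneq => ->; rewrite adj_irrefl.
have us : uniq [:: x; y; z] by rewrite /= !inE negb_or !neq.
have cyc_s : cycle (@adj G) [:: x; y; z] by rewrite /= xy yz adj_sym xz.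
apply: (ssp_le_card_of_cycle us cyc_s) => // f l adj_f f2_neq level_f l0 f_next _.
have : size [:: x; y; z] = 3 by [].
(* Forgetting the three names lets any vertex of the triangle come first. *)
move: [:: x; y; z] us cyc_s l0 f_next => s us cyc_s l0 f_next size_s.
have f_s v : v \in s -> f v \in s by move=> vs; rewrite f_next // mem_next.
have in_s c : c \in s -> forall w, (w \in s) = [|| w == c, w == f c | w == f (f c)].
  move=> cs w; have ut : uniq [:: c; f c; f (f c)].
    by rewrite /= !inE negb_or !(neq _ _ (adj_f _)) eq_sym f2_neq.
  have sub_t : {subset [:: c; f c; f (f c)] <= s}.
    by move=> u; rewrite !in_cons in_nil orbF => /or3P[] /eqP->; [|apply: f_s | apply/f_s/f_s].
  by have [|_ <-] := uniq_min_size ut sub_t; rewrite ?size_s // !in_cons in_nil orbF.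
have f3 c : c \in s -> f (f (f c)) = c.
  move=> cs; have : f (f (f c)) \in s by apply/f_s/f_s/f_s.
  rewrite (in_s c cs) => /or3P[] /eqP // eq3.
    by have := f2_neq (f c); rewrite eq3 eqxx.
  by have := neq _ _ (adj_f (f (f c))); rewrite eq3 eqxx.
have adj_s c d : c \in s -> d \in s -> c != d -> adj c d.
  move=> cs; rewrite (in_s c cs) => /or3P[] /eqP-> ; rewrite ?eqxx ?adj_f //.
  by move=> _; rewrite adj_sym -{2}(f3 c cs) adj_f.
have not_all v c : v \notin s -> c \in s -> adj v c -> adj v (f c) -> adj v (f (f c)) -> False.
  move=> vNs cs v1 v2 v3; apply: not_K4.
  apply: (@clique4_isomorphic G cubic_G connected_G [set u in v :: s]).
    have uvs : uniq (v :: s) by rewrite cons_uniq vNs us.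
    have <- : size (v :: s) = 4 by rewrite /= size_s.
    by rewrite -(card_uniqP uvs); apply: eq_card => u; rewrite inE.
  have vs u : u \in s -> adj v u by rewrite (in_s c cs) => /or3P[] /eqP->.
  move=> a b; rewrite !inE -!/(_ \in s) => /predU1P[->|as_] /predU1P[->|bs].
  - by rewrite eqxx.
  - by move=> _; apply: vs.
  - by move=> _; rewrite adj_sym; apply: vs.
  - exact: adj_s.
have tied_s v u : tied f l v u ->
    [/\ v \notin s, f v \in s, u \in s, adj v u & u != f v].
  case/and4P=> vu uf /eqP lv u_or.
  have fvs : f v \in s by rewrite -l0 level_f lv.
  have vNs : v \notin s by rewrite -l0 lv.
  split=> //; case/or3P: u_or => [/eqP->|/eqP->|/andP[lu _]].
  - exact: f_s.
  - exact/f_s/f_s.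
  - by rewrite -l0.
(* A triangle vertex has only one neighbour off the triangle. *)
have outside d u v : d \in s -> u \notin s -> v \notin s -> adj u d -> adj v d -> u = v.
  move=> ds uNs vNs ud vd.
  have d2 : adj d (f (f d)) by apply: adj_s; rewrite ?f_s // eq_sym f2_neq.
  have [e [_ _ dE]] := third_neighbor cubic_G (adj_f d) d2 (neq _ _ (adj_f _)).
  have only w : w \notin s -> adj d w -> w = e.
    rewrite dE => wNs /or3P[] /eqP wE //; by rewrite wE ?f_s // in wNs.
  by rewrite (only u uNs) 1?adj_sym // (only v vNs) 1?adj_sym.
split.
- by move=> v vs _; apply: f3.
- move=> v a b /tied_s[vNs cs as_ va af] /tied_s[_ _ bs vb bf].
  have := not_all v (f v) vNs cs (adj_f v).
  move: as_ bs; rewrite !(in_s _ cs) (negbTE af) (negbTE bf) /=.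
  by case/orP=> /eqP aE; case/orP=> /eqP bE; move: va vb;
    rewrite aE bE // => -> -> /(_ isT isT).
(* A vertex with a tied neighbour has two neighbours on the triangle, and by [outside] two such
   vertices share none; that would take four triangle vertices. *)
have tied1 v v' a a' : tied f l v a -> tied f l v' a' -> v = v'.
  case/tied_s=> vNs cs as_ va af /tied_s[vNs' cs' as' va' af'].
  apply/eqP; apply: contraT => nvv.
  have ne d d' : d \in s -> adj v d -> adj v' d' -> d' != d.
    move=> ds vd vd'; apply: contraNneq nvv => ed; apply/eqP.
    by apply: (outside d) => //; rewrite -ed.
  have n1 := ne _ _ cs (adj_f v) (adj_f v'); have n2 := ne _ _ cs (adj_f v) va'.
  have n3 := ne _ _ as_ va (adj_f v'); have n4 := ne _ _ as_ va va'.
  move: as_ cs' as' n3 n4 af'; rewrite !(in_s _ cs) (negbTE af) (negbTE n1) (negbTE n2) /=.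
  by do 3![case/orP=> /eqP->]; rewrite ?eqxx.
(* The one vertex that may have a tied neighbour becomes the special vertex; that neighbour is on
   the triangle, hence not a leaf. If there is no such vertex, any non-leaf serves. *)
have [t tP tuniq] : exists2 t : G, (leaf f t -> exists u, [/\ adj t u, u != f t & ~~ leaf f u])
    & forall v u, tied f l v u -> v = t.
  have [[t u] /= tu|none] := pickP (fun q : G * G => tied f l q.1 q.2).
    exists t; last by move=> v a; move/tied1; apply; exact: tu.
    move=> _; have [_ _ us' tu' uf] := tied_s _ _ tu; exists u; split=> //.
    by apply/forallPn; exists (f (f u)); rewrite negbK f3.
  exists (f x); last by move=> v u; rewrite (none (v, u)).
  by move/forallP/(_ x); rewrite eqxx.
have [p pP] := leaf_choice adj_f tP; exists p => v w lv lw vw.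
by case: (pP v w lv lw vw) => [] [nt pE]; [left | right]; split=> // u;
  apply: contra nt => /tuniq->.
Qed.

End Cases.

Theorem theorem3p1 (G : sgraph) (n : nat) (card_G : #|G| = n)
    (connected_G : connected G) (cubic_G : cubic G)
    (not_K4 : ~ isomorphic G (complete 4)) :
  ssp G <= n.
Proof.
rewrite -card_G.
have [[[x y] z] /= /and3P[xy yz xz]|none] :=
  pickP (fun t : G * G * G => [&& adj t.1.1 t.1.2, adj t.1.2 t.2 & adj t.1.1 t.2]).
  exact: (ssp_le_card_triangle cubic_G connected_G not_K4 xy yz xz).
apply: ssp_le_card_triangle_free => // x y z xy yz.
by have := none (x, y, z); rewrite /= xy yz /= => ->.
Qed.
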